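(* Let $\beta>0$ and $\rho\in\,]0,1[$, and let $r_{T_2}^*(\beta,\rho)$, $r_R^*(\rho)$, $r_S^*(\beta,\rho)$ be the optimal rates $$r_{T_2}^*(\beta,\rho)=\frac{1}{1+2\beta\rho},\qquad r_R^*(\rho)=\frac{1-\sqrt{\rho}}{1+\sqrt{\rho}},\qquad r_S^*(\beta,\rho)=\begin{cases}\frac{1}{1+\sqrt{\rho}},&\text{if }\beta\le 4;\\ \frac{2}{2+\sqrt{\beta\rho}},&\text{if }\beta>4.\end{cases}$$ For $\beta>4$ let $$\eta(\beta)=\frac{1-\sqrt{1-4\beta^{-1}}}{1+\sqrt{1-4\beta^{-1}}}\in\,]0,1[.$$ Then the following hold. 1. Suppose that $\beta>4$ and that $\rho\in I(\beta)$, where $$I(\beta)=\left[\frac{\max\{1/16,\eta(\beta)\}}{\beta},\ \frac{1}{\beta\,\eta(\beta)}\right].$$ Then $r_{T_2}^*(\beta,\rho)\le\min\{r_S^*(\beta,\rho),\,r_R^*(\rho)\}$. 2. Suppose that $\beta>16$ and that $\rho<\chi(\beta)$, where $$\chi(\beta)=\min\left\{\frac{1}{16\beta},\ 1-8\,\frac{\sqrt{\beta}-2}{\beta}\right\}.$$ Then $r_S^*(\beta,\rho)<\min\{r_{T_2}^*(\beta,\rho),\,r_R^*(\rho)\}$. In any other case (that is, when neither the hypotheses of item 1 nor those of item 2 hold), $r_R^*(\rho)\le\min\{r_{T_2}^*(\beta,\rho),\,r_S^*(\beta,\rho)\}$.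
   Context: The quantities $r_{T_2}^*,r_R^*,r_S^*$ are the optimal (over the step-size) linear convergence rates, for minimizing $f+g$ with $f$ $\rho$-strongly convex with $1$-Lipschitz gradient and $g$ convex with $\beta^{-1}$-Lipschitz gradient, of forward-backward splitting (proximal step on $f$, gradient step on $g$), Peaceman-Rachford splitting, and Douglas-Rachford splitting, respectively. The claim only uses their explicit formulas. *)

(* Defs.v *)
From HB Require Import structures.
From mathcomp Require Import all_boot all_order all_algebra.
From mathcomp Require Import reals.

Set Implicit Arguments.
Unset Strict Implicit.
Unset Printing Implicit Defensive.

Import Order.TTheory GRing.Theory Num.Theory.
Local Open Scope ring_scope.

(* Optimal linear rates (over the step-size) for minimizing f + g, with f
   rho-strongly convex with 1-Lipschitz gradient and g convex with
   beta^-1-Lipschitz gradient, given by their closed formulas: [rate_T2] for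
   forward-backward splitting (proximal step on f, gradient step on g),
   [rate_R] for Peaceman-Rachford and [rate_S] for Douglas-Rachford. *)
Definition rate_T2 (R : realType) (beta rho : R) : R :=
  1 / (1 + 2 * beta * rho).

Definition rate_R (R : realType) (rho : R) : R :=
  (1 - Num.sqrt rho) / (1 + Num.sqrt rho).

Definition rate_S (R : realType) (beta rho : R) : R :=
  if beta <= 4 then 1 / (1 + Num.sqrt rho)
  else 2 / (2 + Num.sqrt (beta * rho)).

(* Meaningful for beta > 4 only: [Num.sqrt] is 0 on negative arguments. *)
Definition eta_beta (R : realType) (beta : R) : R :=
  (1 - Num.sqrt (1 - 4 * beta^-1)) / (1 + Num.sqrt (1 - 4 * beta^-1)).

Definition I_beta (R : realType) (beta : R) : interval R :=
  `[Num.max (1 / 16) (eta_beta beta) / beta, 1 / (beta * eta_beta beta)].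

Definition chi (R : realType) (beta : R) : R :=
  Num.min (1 / (16 * beta)) (1 - 8 * ((Num.sqrt beta - 2) / beta)).

(* Main.v *)
Require Import Defs.
From HB Require Import structures.
From mathcomp Require Import all_boot all_order all_algebra.
From mathcomp Require Import reals.
From mathcomp Require Import ring lra.

Set Implicit Arguments.
Unset Strict Implicit.
Unset Printing Implicit Defensive.

Import Order.TTheory GRing.Theory Num.Theory.
Local Open Scope ring_scope.

(** Put [s = sqrt rho] and [b = sqrt beta]. After clearing denominators the
    pairwise comparisons of the three rates read [1 <= beta * s * (1 - s)] for
    T2 against R and, when [beta > 4], [1 <= 16 * beta * rho] for T2 against S
    and [4 < b * (1 - s)] for S against R. The roots of
    [beta * s * (1 - s) = 1] have product [1 / beta] and quotient [eta], hence
    squares [eta / beta] and [1 / (beta * eta)]. So [rho \in I beta] says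
    exactly that T2 is a smallest rate, and [16 < beta /\ rho < chi beta] that S
    is strictly smallest. *)

Lemma ltr_sqr_pos (R : realDomainType) (x y : R) :
  0 <= x -> (x ^+ 2 < y ^+ 2) && (0 < y) = (x < y).
Proof.
move=> x0; have [y0|y0] := ltP 0 y; first by rewrite andbT ltr_pXn2r ?nnegrE // ltW.
by rewrite andbF ltNge (le_trans y0 x0).
Qed.

Lemma rate_R_sqr (R : realType) (s : R) :
  0 < s -> rate_R (s ^+ 2) = (1 - s) / (1 + s).
Proof. by move=> s0; rewrite /rate_R sqrtr_sqr gtr0_norm. Qed.

Lemma rate_S_sqr (R : realType) (b s : R) : 0 < b -> 0 < s ->
  rate_S (b ^+ 2) (s ^+ 2) =
    if b ^+ 2 <= 4 then 1 / (1 + s) else 2 / (2 + b * s).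
Proof.
move=> b0 s0.
by rewrite /rate_S -exprMn !sqrtr_sqr !gtr0_norm // mulr_gt0.
Qed.

(** One factorization with an unspecified positive factor serves both directions of the
    comparison. *)
Lemma rate_R_sub_T2 (R : realType) (beta s : R) : 0 < beta -> 0 < s ->
  exists2 c, 0 < c & rate_R (s ^+ 2) - rate_T2 beta (s ^+ 2) =
    c * (beta * s * (1 - s) - 1).
Proof.
move=> beta0 s0; have bs0 : 0 < beta * s ^+ 2 by rewrite mulr_gt0 ?exprn_gt0.
exists (2 * s / ((1 + s) * (1 + 2 * beta * s ^+ 2))).
  by rewrite divr_gt0 ?mulr_gt0 //; lra.
rewrite rate_R_sqr // /rate_T2.
by field; rewrite !gt_eqF //; lra.
Qed.

Lemma rate_T2_le_R (R : realType) (beta s : R) : 0 < beta -> 0 < s ->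
  (rate_T2 beta (s ^+ 2) <= rate_R (s ^+ 2)) = (1 <= beta * s * (1 - s)).
Proof.
move=> beta0 s0; have [c c0 cE] := rate_R_sub_T2 beta0 s0.
by rewrite -[LHS]subr_ge0 cE pmulr_rge0 ?subr_ge0.
Qed.

Lemma rate_R_le_T2 (R : realType) (beta s : R) : 0 < beta -> 0 < s ->
  (rate_R (s ^+ 2) <= rate_T2 beta (s ^+ 2)) = (beta * s * (1 - s) <= 1).
Proof.
move=> beta0 s0; have [c c0 cE] := rate_R_sub_T2 beta0 s0.
by rewrite -[LHS]subr_le0 cE pmulr_rle0 ?subr_le0.
Qed.

Lemma rate_T2_le_S (R : realType) (b s : R) : 0 < b -> 0 < s -> 4 < b ^+ 2 ->
  (rate_T2 (b ^+ 2) (s ^+ 2) <= rate_S (b ^+ 2) (s ^+ 2)) =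
    (1 / 16 <= b ^+ 2 * s ^+ 2).
Proof.
move=> b0 s0 b4; rewrite /rate_T2 rate_S_sqr // [b ^+ 2 <= 4]leNgt b4 /=.
rewrite -[2 * b ^+ 2 * _]mulrA -exprMn.
move: (b * s) (mulr_gt0 b0 s0) => t t0.
have t2 : 0 < t ^+ 2 by rewrite exprn_gt0.
rewrite ler_pdivrMr; last lra.
rewrite mulrAC ler_pdivlMr; last lra.
rewrite mul1r.
(* The left inequality is [2 + t <= 2 * (1 + 2 * t ^+ 2)]; dividing by [t] leaves [1 <= 4 * t]. *)
by apply/idP/idP => ht; nra.
Qed.

Lemma rate_S_lt_R (R : realType) (b s : R) : 0 < b -> 0 < s -> s < 1 ->
  (rate_S (b ^+ 2) (s ^+ 2) < rate_R (s ^+ 2)) = (4 < b * (1 - s)).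
Proof.
move=> b0 s0 s1; rewrite rate_S_sqr // rate_R_sqr //.
have bs0 : 0 < b * s by rewrite mulr_gt0.
case: (leP (b ^+ 2) 4) => [b4|b4].
  (* Both sides are false here: the rates share the denominator [1 + s], and [b * (1 - s) < 2]. *)
  have b2 : b <= 2 by nra.
  rewrite ltr_pM2r ?invr_gt0; last lra.
  by apply/idP/idP => ?; [lra|nra].
rewrite ltr_pdivrMr; last lra.
rewrite mulrAC ltr_pdivlMr; last lra.
rewrite -[LHS]subr_gt0 -[RHS]subr_gt0 -[RHS](pmulr_rgt0 _ s0).
by congr (_ < _); ring.
Qed.

(** The second bound in [chi] is the perfect square [(1 - 4 / b) ^+ 2]; the condition [16 < b ^+ 2]
    restores the sign of [1 - 4 / b] that squaring loses. *)
Lemma mulrB_gt4 (R : realType) (b s : R) : 0 < b -> 0 < s ->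
  (4 < b * (1 - s)) =
    (16 < b ^+ 2) && (s ^+ 2 < 1 - 8 * ((b - 2) / b ^+ 2)).
Proof.
move=> b0 s0.
have -> : 1 - 8 * ((b - 2) / b ^+ 2) = (1 - 4 / b) ^+ 2.
  by field; rewrite gt_eqF.
have -> : (16 < b ^+ 2) = (0 < 1 - 4 / b).
  rewrite subr_gt0 ltr_pdivrMr // mul1r.
  by apply/idP/idP => ?; nra.
rewrite andbC ltr_sqr_pos ?(ltW s0) //.
rewrite ltrBrDl -ltrBrDr ltr_pdivrMr // mulrC.
by congr (_ < _); ring.
Qed.

Lemma sqrt_discr_itv (R : realType) (beta : R) : 4 < beta ->
  0 < Num.sqrt (1 - 4 * beta^-1) < 1.
Proof.
move=> beta4; have beta0 : 0 < beta by lra.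
rewrite -[X in _ && (_ < X)]sqrtr1 sqrtr_gt0 ltr_sqrt // subr_gt0.
by rewrite ltr_pdivrMr // mul1r beta4 gtrBl divr_gt0.
Qed.

Lemma eta_beta_itv (R : realType) (beta : R) :
  4 < beta -> eta_beta beta \in `]0, 1[.
Proof.
move=> /sqrt_discr_itv; rewrite in_itv /= /eta_beta.
move: (Num.sqrt _) => d /andP[d0 d1].
by rewrite divr_gt0 ?ltr_pdivrMr; lra.
Qed.

Lemma rate_T2_le_R_eta (R : realType) (beta s : R) : 0 < s -> 4 < beta ->
  (rate_T2 beta (s ^+ 2) <= rate_R (s ^+ 2)) =
  (eta_beta beta / beta <= s ^+ 2 <= 1 / (beta * eta_beta beta)).
Proof.
move=> s0 beta4; have beta0 : 0 < beta by lra.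
rewrite rate_T2_le_R // /eta_beta.
have : (Num.sqrt (1 - 4 * beta^-1)) ^+ 2 = 1 - 4 * beta^-1.
  by rewrite sqr_sqrtr // subr_ge0 ler_pdivrMr // mul1r ltW.
have := sqrt_discr_itv beta4; move: (Num.sqrt _) => d /andP[d0 d1] dE.
(* With [beta] rational in [d], no square root is left and [field] can identify the endpoints as
   squares of the roots [(1 - d) / 2] and [(1 + d) / 2]. *)
have betaE : beta = 4 / ((1 - d) * (1 + d)).
  have -> : (1 - d) * (1 + d) = 4 * beta^-1.
    by transitivity (1 - d ^+ 2); [ring|rewrite dE; ring].
  by field; rewrite gt_eqF.
have -> : (1 - d) / (1 + d) / beta = ((1 - d) / 2) ^+ 2.
  by rewrite betaE; field; rewrite !gt_eqF //; lra.
have -> : 1 / (beta * ((1 - d) / (1 + d))) = ((1 + d) / 2) ^+ 2.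
  by rewrite betaE; field; rewrite !gt_eqF //; lra.
rewrite !ler_pXn2r ?nnegrE //; [|lra..].
have -> : (1 <= beta * s * (1 - s)) =
    (0 <= (s - (1 - d) / 2) * ((1 + d) / 2 - s)).
  rewrite -[LHS]subr_ge0 -[RHS](pmulr_rge0 _ beta0); congr (_ <= _).
  by rewrite betaE; field; rewrite !gt_eqF //; lra.
(* The two factors add up to [d > 0], so they cannot both be negative. *)
by apply/idP/andP => [h|[h1 h2]]; [split; nra|apply: mulr_ge0; lra].
Qed.

Lemma mem_I_beta (R : realType) (b s : R) : 0 < b -> 0 < s -> 4 < b ^+ 2 ->
  (s ^+ 2 \in I_beta (b ^+ 2)) =
  (rate_T2 (b ^+ 2) (s ^+ 2) <=
     Num.min (rate_S (b ^+ 2) (s ^+ 2)) (rate_R (s ^+ 2))).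
Proof.
move=> b0 s0 b4; have b20 : 0 < b ^+ 2 by rewrite exprn_gt0.
rewrite in_itv /= le_min rate_T2_le_S // rate_T2_le_R_eta //.
by rewrite !(ler_pdivrMr _ _ b20) ge_max andbA [s ^+ 2 * _]mulrC.
Qed.

Lemma lt_chi (R : realType) (b s : R) : 0 < b -> 0 < s -> s < 1 ->
  (16 < b ^+ 2) && (s ^+ 2 < chi (b ^+ 2)) =
  (4 < b ^+ 2) && (rate_S (b ^+ 2) (s ^+ 2) <
    Num.min (rate_T2 (b ^+ 2) (s ^+ 2)) (rate_R (s ^+ 2))).
Proof.
move=> b0 s0 s1; rewrite /chi sqrtr_sqr gtr0_norm // !lt_min.
rewrite rate_S_lt_R // mulrB_gt4 //.
(* If [b ^+ 2 <= 16], S is not below R and both sides are false. *)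
have [b16|] := ltP 16 (b ^+ 2); last by rewrite !andbF.
have b4 : 4 < b ^+ 2 by lra.
rewrite b4 [_ < rate_T2 _ _]ltNge rate_T2_le_S // -ltNge /=; congr (_ && _).
by rewrite !ltr_pdivlMr; [congr (_ < _); ring|lra..].
Qed.

Lemma rate_R_le_small_beta (R : realType) (b s : R) :
  0 < b -> 0 < s -> s < 1 -> b ^+ 2 <= 4 ->
  rate_R (s ^+ 2) <=
    Num.min (rate_T2 (b ^+ 2) (s ^+ 2)) (rate_S (b ^+ 2) (s ^+ 2)).
Proof.
move=> b0 s0 s1 b4; have b20 : 0 < b ^+ 2 by rewrite exprn_gt0.
rewrite le_min [X in _ && X]leNgt rate_S_lt_R // mulrB_gt4 //.
rewrite ltNge (le_trans b4) ?ler_nat //= andbT rate_R_le_T2 //.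
(* The square gives [s * (1 - s) <= 1 / 4], and [b ^+ 2 <= 4]. *)
by have := sqr_ge0 (2 * s - 1); nra.
Qed.

Theorem proposition7 (R : realType) (beta rho : R)
    (beta_gt0 : 0 < beta) (rho01 : rho \in `]0, 1[) :
  [/\ 4 < beta -> eta_beta beta \in `]0, 1[,
      4 < beta /\ rho \in I_beta beta ->
        rate_T2 beta rho <= Num.min (rate_S beta rho) (rate_R rho),
      16 < beta /\ rho < chi beta ->
        rate_S beta rho < Num.min (rate_T2 beta rho) (rate_R rho)
    & ~ (4 < beta /\ rho \in I_beta beta) ->
      ~ (16 < beta /\ rho < chi beta) ->
        rate_R rho <= Num.min (rate_T2 beta rho) (rate_S beta rho)].
Proof.
have /andP[rho_gt0 rho_lt1] : 0 < rho < 1 by move: rho01; rewrite in_itv.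
split; first exact: eta_beta_itv.
all: have b0 : 0 < Num.sqrt beta by rewrite sqrtr_gt0.
all: have s0 : 0 < Num.sqrt rho by rewrite sqrtr_gt0.
all: have s1 : Num.sqrt rho < 1 by rewrite -[ltRHS]sqrtr1 ltr_sqrt.
all: rewrite -(sqr_sqrtr (ltW beta_gt0)) -(sqr_sqrtr (ltW rho_gt0)).
all: move: (Num.sqrt beta) (Num.sqrt rho) b0 s0 s1 => b s b0 s0 s1.
- by case=> b4; rewrite mem_I_beta.
- by move=> /andP; rewrite lt_chi // => /andP[].
move=> /andP notI /andP; rewrite lt_chi //.
have [b4|b4 _] := ltP 4 (b ^+ 2); last exact: rate_R_le_small_beta.
(* Once [4 < b ^+ 2], only the order of the three rates matters: if T2 is not a minimum and S is not
   strictly below both others, then R is a minimum. *)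
move: notI; rewrite b4 mem_I_beta //= !lt_min !le_min.
case: leP; case: leP; case: leP => //=.
all: lra.
Qed.
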